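(* (Zero-stability of discrete latent dynamics models.) Fix $\boldsymbol{\mu}\in\mathcal{P}$. Let $\Psi:\mathbb{R}^{N_h}\to\mathbb{R}^n$ and $\Psi':\mathbb{R}^n\to\mathbb{R}^{N_h}$ be Lipschitz continuous and let the increment function $\Phi$ be Lipschitz continuous in its second variable with constant $Lip(\Phi)$ independent of $\Delta t$ and of the nodes $t_k$. Consider the discrete latent dynamics model $$\tilde{\mathbf{u}}_h^k=\Psi'(\mathbf{u}_n^k),\quad\mathbf{u}_n^k=\mathbf{u}_n^{k-1}+\Delta t\,\Phi(t_{k-1},\mathbf{u}_n^{k-1};\mathbf{f}_n,\Delta t),\quad k=1,\dots,N_{\Delta t},\qquad\mathbf{u}_n^0=\Psi(\mathbf{u}_{0,h}),$$ and its perturbation $$\tilde{\mathbf{z}}_h^k=\Psi'(\mathbf{z}_n^k),\quad\mathbf{z}_n^k=\mathbf{z}_n^{k-1}+\Delta t\big(\Phi(t_{k-1},\mathbf{z}_n^{k-1};\mathbf{f}_n,\Delta t)+\boldsymbol{\delta}_n^k\big),\quad k=1,\dots,N_{\Delta t},\qquad\mathbf{z}_n^0=\Psi(\mathbf{u}_{0,h}+\boldsymbol{\delta}_h^0),$$ with $\boldsymbol{\delta}_h^0\in\mathbb{R}^{N_h}$, $\boldsymbol{\delta}_n^k\in\mathbb{R}^n$. Then there exist $\Delta t^*>0$ and $\tilde{C}>0$ such that, for all $\Delta t\le\Delta t^*$ and all $\varepsilon>0$ small enough, if $\|\boldsymbol{\delta}_h^0\|\le\varepsilon$ and $\|\boldsymbol{\delta}_n^k\|\le\varepsilon$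 for $1\le k\le N_{\Delta t}$, then $$\|\tilde{\mathbf{z}}_h^k-\tilde{\mathbf{u}}_h^k\|\le\tilde{C}\varepsilon,\qquad1\le k\le N_{\Delta t},$$ and one can take $\tilde{C}=Lip(\Psi')\,\big(Lip(\Psi)+|T-t_0|\big)\,e^{Lip(\Phi)|T-t_0|}$.
   Context: $\mathcal{P}\subset\mathbb{R}^{n_\mu}$ is a compact parameter set (dependence on the fixed $\boldsymbol{\mu}$ omitted), $\mathbf{u}_{0,h}\in\mathbb{R}^{N_h}$ is the full-order initial value, $n\ll N_h$, $\|\cdot\|$ is the Euclidean norm, $Lip(\cdot)$ denotes a Lipschitz constant. $[t_0,T]$ is divided into $N_{\Delta t}$ intervals of width $\Delta t$, with $t_k=t_0+k\Delta t$. $\Phi$ is the increment function of an explicit one-step (Runge-Kutta) method applied to the latent equation $\dot{\mathbf{u}}_n=\mathbf{f}_n(t,\mathbf{u}_n)$. *)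

(* Defs.v *)
From HB Require Import structures.
From mathcomp Require Import all_boot all_order all_algebra.
From mathcomp Require Import all_classical all_reals all_analysis.

Set Implicit Arguments.
Unset Strict Implicit.
Unset Printing Implicit Defensive.

Import Order.TTheory GRing.Theory Num.Theory.
Import numFieldNormedType.Exports.

Local Open Scope ring_scope.

(* The library norm `|x| on matrices is the sup norm, and k.-lipschitz refers
   to it; the Euclidean versions are therefore spelled out. *)
Definition enorm (R : realType) (m : nat) (x : 'cV[R]_m) : R :=
  Num.sqrt (\sum_(i < m) x i 0 ^+ 2).

Definition lipschitz_const (R : realType) (m p : nat)
    (F : 'cV[R]_m -> 'cV[R]_p) (L : R) : Prop :=
  0 <= L /\ forall x y, enorm (F x - F y) <= L * enorm (x - y).

Definition vector_field (R : realType) (n : nat) := R -> 'cV[R]_n -> 'cV[R]_n.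

(* [Phi t u f dt] is Phi(t, u; f, dt). An explicit one-step method is
   determined by its increment function; explicit Runge-Kutta methods are
   instances. *)
Definition increment_function (R : realType) (n : nat) :=
  R -> 'cV[R]_n -> vector_field R n -> R -> 'cV[R]_n.

Definition node (R : realType) (t0 dt : R) (k : nat) : R := t0 + k%:R * dt.

Definition step (R : realType) (t0 T : R) (N : nat) : R := (T - t0) / N%:R.

Fixpoint latent (R : realType) (n : nat) (Phi : increment_function R n)
    (f : vector_field R n) (t0 dt : R) (v : 'cV[R]_n) (k : nat) : 'cV[R]_n :=
  if k is k'.+1 then
    let u := latent Phi f t0 dt v k' in
    u + dt *: Phi (node t0 dt k') u f dt
  else v.

(* Only the values [d k] with [1 <= k] are used. *)
Fixpoint perturbed_latent (R : realType) (n : nat)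
    (Phi : increment_function R n) (f : vector_field R n) (t0 dt : R)
    (d : nat -> 'cV[R]_n) (v : 'cV[R]_n) (k : nat) : 'cV[R]_n :=
  if k is k'.+1 then
    let z := perturbed_latent Phi f t0 dt d v k' in
    z + dt *: (Phi (node t0 dt k') z f dt + d k'.+1)
  else v.

(* Perturbations of size at most [eps <= eps0] change the reconstructed
   solution by at most [C * eps], for every uniform subdivision of [t0, T] of
   width at most [dtstar]. *)
Definition zero_stable_with (R : realType) (Nh n : nat)
    (Psi : 'cV[R]_Nh -> 'cV[R]_n) (Psi' : 'cV[R]_n -> 'cV[R]_Nh)
    (Phi : increment_function R n) (f : vector_field R n) (t0 T : R)
    (u0h : 'cV[R]_Nh) (dtstar eps0 C : R) : Prop :=
  forall N : nat, (0 < N)%N ->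
  let dt := step t0 T N in
  dt <= dtstar ->
  forall eps : R, 0 < eps <= eps0 ->
  forall (d0 : 'cV[R]_Nh) (d : nat -> 'cV[R]_n),
  enorm d0 <= eps ->
  (forall k, (1 <= k <= N)%N -> enorm (d k) <= eps) ->
  forall k, (1 <= k <= N)%N ->
    enorm (Psi' (perturbed_latent Phi f t0 dt d (Psi (u0h + d0)) k)
           - Psi' (latent Phi f t0 dt (Psi u0h) k)) <= C * eps.

(* Main.v *)
Require Import Defs.
From HB Require Import structures.
From mathcomp Require Import all_boot all_order all_algebra.
From mathcomp Require Import all_classical all_reals all_analysis.
From mathcomp Require Import ring.
Import Order.TTheory GRing.Theory Num.Theory.
Import numFieldNormedType.Exports.
Local Open Scope ring_scope.

(** The encoder multiplies the initial error by at most [LPsi].  One step of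
    the method multiplies the latent error by at most
    [1 + dt * LPhi <= expR (LPhi * dt)] and adds at most [dt * eps]
    ([enorm_perturbed_step]).  After [k] steps the exponential factors compose
    to [expR (LPhi * (k * dt))], while the added errors, each amplified by at
    most this factor, contribute at most [k * dt * eps] times it
    ([discrete_gronwall]).  Since [k * dt <= T - t0], the resulting bound does
    not depend on the number of steps, and the decoder multiplies it by at
    most [LPsi'].  The argument uses the triangle inequality for the Euclidean
    norm ([enormD]), which rests on [enorm_cauchy_schwarz]. *)

Lemma enorm_ge0 {R : realType} {m : nat} (x : 'cV[R]_m) : 0 <= enorm x.
Proof. exact: sqrtr_ge0. Qed.

Lemma enorm_sqr {R : realType} {m : nat} (x : 'cV[R]_m) :
  enorm x ^+ 2 = \sum_(i < m) x i 0 ^+ 2.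
Proof. by rewrite sqr_sqrtr// sumr_ge0// => i _; rewrite sqr_ge0. Qed.

Lemma enorm_eq0 {R : realType} {m : nat} (x : 'cV[R]_m) :
  enorm x = 0 -> x = 0.
Proof.
move=> x0; have := enorm_sqr x; rewrite x0 expr0n/= => /esym/eqP.
rewrite psumr_eq0 => [/allP x20|i _]; last exact: sqr_ge0.
apply/matrixP => i j; rewrite ord1 mxE; apply/eqP.
by have := x20 i (mem_index_enum _); rewrite sqrf_eq0.
Qed.

Lemma enormZ {R : realType} {m : nat} (a : R) (x : 'cV[R]_m) :
  0 <= a -> enorm (a *: x) = a * enorm x.
Proof.
move=> a0; rewrite /enorm.
under eq_bigr do rewrite mxE exprMn.
by rewrite -mulr_sumr sqrtrM ?sqr_ge0// sqrtr_sqr ger0_norm.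
Qed.

(** Cauchy-Schwarz: expand the nonnegative sum of the squares
    [(enorm y * x_i - enorm x * y_i) ^+ 2], and divide by
    [enorm x * enorm y] when this product is positive. *)
Lemma enorm_cauchy_schwarz {R : realType} {m : nat} (x y : 'cV[R]_m) :
  \sum_(i < m) x i 0 * y i 0 <= enorm x * enorm y.
Proof.
have [/eqP x0|x0] := boolP (enorm x == 0).
  rewrite x0 mul0r (enorm_eq0 x x0) big1// => i _.
  by rewrite mxE mul0r.
have [/eqP y0|y0] := boolP (enorm y == 0).
  rewrite y0 mulr0 (enorm_eq0 y y0) big1// => i _.
  by rewrite mxE mulr0.
have xy0 : 0 < enorm x * enorm y.
  by rewrite mulr_gt0// lt_neqAle enorm_ge0 eq_sym ?x0 ?y0.
have : 0 <= \sum_(i < m) (enorm y * x i 0 - enorm x * y i 0) ^+ 2.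
  by apply: sumr_ge0 => i _; exact: sqr_ge0.
have -> : \sum_(i < m) (enorm y * x i 0 - enorm x * y i 0) ^+ 2 =
    2 * (enorm x * enorm y) *
    (enorm x * enorm y - \sum_(i < m) x i 0 * y i 0).
  transitivity (\sum_(i < m) (enorm y ^+ 2 * x i 0 ^+ 2 +
      enorm x ^+ 2 * y i 0 ^+ 2 -
      2 * (enorm x * enorm y) * (x i 0 * y i 0))).
    by apply: eq_bigr => i _; ring.
  by rewrite !(big_split, sumrN)/= -!mulr_sumr -!enorm_sqr; ring.
by rewrite (pmulr_rge0 _ (mulr_gt0 (ltr0Sn R 1) xy0)) subr_ge0.
Qed.

Lemma enormD {R : realType} {m : nat} (x y : 'cV[R]_m) :
  enorm (x + y) <= enorm x + enorm y.
Proof.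
rewrite -ler_sqr ?nnegrE ?addr_ge0 ?enorm_ge0// enorm_sqr.
under eq_bigr do rewrite mxE sqrrD.
rewrite 2!big_split/= sumrMnl -!enorm_sqr sqrrD.
by rewrite lerD2r lerD2l lerMn2r enorm_cauchy_schwarz.
Qed.

(** In the inductive step [1 + h * L <= expR (L * h)] absorbs the
    amplification of the old error, and the new contribution [h * b] may be
    multiplied by the whole exponential, which is at least [1]. *)
Lemma discrete_gronwall {R : realType} {N : nat} (h L a b : R) (e : nat -> R) :
  0 <= h -> 0 <= L -> 0 <= a -> 0 <= b ->
  e 0%N <= a ->
  (forall k, (k < N)%N -> e k.+1 <= (1 + h * L) * e k + h * b) ->
  forall k, (k <= N)%N -> e k <= (a + k%:R * h * b) * expR (L * (k%:R * h)).
Proof.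
move=> h0 L0 a0 b0 e0 eS; elim=> [_|k IHk kN].
  by rewrite !mul0r mulr0 expR0 addr0 mulr1.
have ck0 : 0 <= a + k%:R * h * b by rewrite addr_ge0// !mulr_ge0.
apply: (le_trans (eS k kN)).
have -> : a + k.+1%:R * h * b = (a + k%:R * h * b) + h * b.
  by rewrite -natr1; ring.
rewrite [leRHS]mulrDl lerD//; last first.
  by rewrite ler_peMr ?mulr_ge0// -expR0 ler_expR !mulr_ge0.
have -> : L * (k.+1%:R * h) = L * h + L * (k%:R * h).
  by rewrite -natr1; ring.
have amp0 : 0 <= 1 + h * L by rewrite addr_ge0 ?mulr_ge0.
apply: (le_trans (ler_wpM2l amp0 (IHk (ltnW kN)))).
rewrite expRD mulrCA ler_wpM2l// ler_wpM2r ?expR_ge0//.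
by rewrite (mulrC L h) expR_ge1Dx.
Qed.

(** The difference of the two steps is the old error, plus [dt] times an
    increment difference bounded by [L] times the old error, plus [dt] times
    the perturbation. *)
Lemma enorm_perturbed_step {R : realType} {m : nat} (F : 'cV[R]_m -> 'cV[R]_m)
    (L dt : R) (z u d : 'cV[R]_m) :
  lipschitz_const F L -> 0 <= dt ->
  enorm ((z + dt *: (F z + d)) - (u + dt *: F u)) <=
  (1 + dt * L) * enorm (z - u) + dt * enorm d.
Proof.
move=> [L0 FL] dt0.
have -> : (z + dt *: (F z + d)) - (u + dt *: F u) =
    (z - u) + dt *: (F z - F u) + dt *: d.
  by apply/matrixP => i j; rewrite !mxE; ring.
apply: (le_trans (enormD _ _)); rewrite enormZ// lerD2r.
apply: (le_trans (enormD _ _)); rewrite enormZ// mulrDl mul1r lerD2l -mulrA.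
by rewrite ler_wpM2l.
Qed.

Lemma step_gt0 {R : realType} (t0 T : R) (N : nat) :
  t0 < T -> (0 < N)%N -> 0 < step t0 T N.
Proof. by move=> tT N0; rewrite divr_gt0 ?subr_gt0 ?ltr0n. Qed.

Lemma natr_step_le {R : realType} (t0 T : R) (N k : nat) :
  t0 < T -> (0 < N)%N -> (k <= N)%N -> k%:R * step t0 T N <= T - t0.
Proof.
move=> tT N0 kN; rewrite /step mulrCA ler_piMr ?subr_ge0 ?(ltW tT)//.
by rewrite ler_pdivrMr ?ltr0n// mul1r ler_nat.
Qed.

Lemma enorm_perturbed_latent {R : realType} {n : nat}
    (Phi : increment_function R n) (f : vector_field R n)
    (t0 dt L a eps : R) (N : nat) (d : nat -> 'cV[R]_n) (v w : 'cV[R]_n) :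
  0 <= dt -> 0 <= L -> 0 <= a -> 0 <= eps ->
  (forall k, (k <= N)%N ->
    lipschitz_const (fun u => Phi (node t0 dt k) u f dt) L) ->
  (forall k, (1 <= k <= N)%N -> enorm (d k) <= eps) ->
  enorm (w - v) <= a ->
  forall k, (k <= N)%N ->
    enorm (perturbed_latent Phi f t0 dt d w k - latent Phi f t0 dt v k) <=
    (a + k%:R * dt * eps) * expR (L * (k%:R * dt)).
Proof.
move=> dt0 L0 a0 eps0 PhiL d_eps wv.
apply: discrete_gronwall => // k kN.
apply: (le_trans (enorm_perturbed_step _ _ _ _ _ _ (PhiL k (ltnW kN)) dt0)).
by rewrite lerD2l ler_wpM2l// d_eps.
Qed.

Theorem mainTheorem6 (R : realType) (nmu Nh n : nat) (hn : (n < Nh)%N)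
    (P : set 'cV[R]_nmu) (hP : compact P) (mu : 'cV[R]_nmu) (hmu : P mu)
    (t0 T : R) (hT : t0 < T)
    (u0h : 'cV[R]_nmu -> 'cV[R]_Nh)
    (fn : 'cV[R]_nmu -> vector_field R n)
    (Phi : increment_function R n)
    (Psi : 'cV[R]_Nh -> 'cV[R]_n) (Psi' : 'cV[R]_n -> 'cV[R]_Nh)
    (LPsi LPsi' LPhi : R)
    (hPsi : lipschitz_const Psi LPsi)
    (hPsi' : lipschitz_const Psi' LPsi')
    (hPhi : forall N k : nat, (0 < N)%N -> (k <= N)%N ->
       let dt := step t0 T N in
       lipschitz_const (fun u => Phi (node t0 dt k) u (fn mu) dt) LPhi) :
  exists dtstar eps0 : R,
    [/\ 0 < dtstar,
        0 < eps0,
        exists2 C : R, 0 < C &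
          zero_stable_with Psi Psi' Phi (fn mu) t0 T (u0h mu) dtstar eps0 C
      & zero_stable_with Psi Psi' Phi (fn mu) t0 T (u0h mu) dtstar eps0
          (LPsi' * (LPsi + `|T - t0|) * expR (LPhi * `|T - t0|))].
Proof.
set C := LPsi' * _ * _.
have [LPsi0 PsiL] := hPsi; have [LPsi'0 Psi'L] := hPsi'.
have [LPhi0 _] := hPhi 1%N 0%N isT isT.
have T0 : `|T - t0| = T - t0 by rewrite gtr0_norm// subr_gt0.
have stable : zero_stable_with Psi Psi' Phi (fn mu) t0 T (u0h mu) 1 1 C.
  move=> N N0 dt _ eps /andP[/ltW eps0 _] d0 d d0_eps d_eps k /andP[_ kN].
  have dt0 : 0 <= dt by rewrite ltW// step_gt0.
  have init : enorm (Psi (u0h mu + d0) - Psi (u0h mu)) <= LPsi * eps.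
    by rewrite (le_trans (PsiL _ _))// addrAC subrr add0r ler_wpM2l.
  apply: (le_trans (Psi'L _ _)).
  have -> : C * eps =
      LPsi' * ((LPsi * eps + (T - t0) * eps) * expR (LPhi * (T - t0))).
    by rewrite /C T0; ring.
  rewrite ler_wpM2l//.
  apply: (le_trans (enorm_perturbed_latent _ _ _ _ _ _ _ _ _ _ _ dt0 LPhi0
    (mulr_ge0 LPsi0 eps0) eps0 (fun j => hPhi N j N0) d_eps init k kN)).
  have kdt : k%:R * dt <= T - t0 by exact: natr_step_le.
  apply: ler_pM; [| exact: expR_ge0 | |].
  - apply: addr_ge0 (mulr_ge0 LPsi0 eps0) _.
    exact: mulr_ge0 (mulr_ge0 (ler0n _ _) dt0) eps0.
  - by rewrite lerD2l ler_wpM2r.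
  - by rewrite ler_expR ler_wpM2l.
(* The estimate is uniform in the step width and linear in the size of the
   perturbation, so any positive thresholds serve. *)
exists 1, 1; split=> //.
(* [C] vanishes when [LPsi' = 0], so a positive constant has to be larger. *)
have C0 : 0 <= C by rewrite !mulr_ge0 ?addr_ge0 ?expR_ge0.
exists (C + 1); first by rewrite ltr_wpDl.
move=> N N0 dt dt1 eps heps d0 d hd0 hd k hk.
apply: (le_trans (stable N N0 dt1 eps heps d0 d hd0 hd k hk)).
by have /andP[/ltW eps0 _] := heps; rewrite ler_wpM2r// lerDl.
Qed.
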